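(* A point $(w^*,b^*,v^*,u^* )$ is a limiting stationary point of problem (PP) if and only if $(w^*,b^*,v^*,u^* )$ is a KKT point of problem (PP).
   Context: Setting. $[K]=\{1,\dots,K\}$; $\|\cdot\|$ is the Euclidean norm. $L,N,N_0,\dots,N_L$ are positive integers, $x_n\in\mathbb R^{N_0}$ and $y_n\in\mathbb R^{N_L}$ ($n\in[N]$) are given data, and $0<\alpha<1$, $\lambda_w>0$, $\lambda_v>0$, $\beta_\ell>0$ ($\ell\in[L]$) are constants. $\sigma(z)=\max\{z,\alpha z\}$ componentwise. Variables. $W_\ell\in\mathbb R^{N_\ell\times N_{\ell-1}}$, $b_\ell\in\mathbb R^{N_\ell}$, $v_{n,\ell},u_{n,\ell}\in\mathbb R^{N_\ell}$ for $\ell\in[L]$, $n\in[N]$, with $v_{n,0}:=x_n$. Put $\widetilde N=\sum_{\ell=1}^LN_\ell N_{\ell-1}$, $\overline N=\sum_{\ell=1}^LN_\ell$, $m=N\overline N$. The vectors $w\in\mathbb R^{\widetilde N}$ (stacking the column-wise vectorizations of $W_1,\dots,W_L$), $b\in\mathbb R^{\overline N}$ (stacking $b_1,\dots,b_L$), and $v,u\in\mathbb R^m$ (stacking $v_{n,\ell}$, resp. $u_{n,\ell}$, in the order $(1,1),(2,1),\dots,(N,1),(1,2),\dots,(N,L)$ of $(n,\ell)$) collect the variables. The linear-in-$w$ map $\Psi(v)w$ and the matrix $A\in\mathbb R^{m\times\overline N}$ are such that $\Psi(v)w+Ab$ has $(n,\ell)$ block $W_\ell v_{n,\ell-1}+b_\ell$;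 that is, $\Psi(v)$ is block diagonal with blocks $V_{\ell-1}^\top\otimes I_{N_\ell}$, where $V_\ell=(v_{1,\ell},\dots,v_{N,\ell})$, $V_0=(x_1,\dots,x_N)$, and $A$ is block diagonal with blocks $e_N\otimes I_{N_\ell}$ ($e_K$ is the all-ones vector in $\mathbb R^K$). Objective. $\mathcal R_1(w)=\lambda_w\sum_{\ell=1}^L\sum_{j=1}^{N_{\ell-1}}\|(W_\ell)_{\cdot,j}\|$ (with $(W_\ell)_{\cdot,j}$ the $j$-th column), $\mathcal R_2(v)=\lambda_v\|v\|^2$, $\bar{\mathcal O}(w,v)=\frac1N\sum_{n=1}^N\|v_{n,L}-y_n\|^2+\mathcal R_1(w)+\mathcal R_2(v)$. With $\beta=(\beta_1e_{NN_1}^\top,\dots,\beta_Le_{NN_L}^\top)^\top\in\mathbb R^m$, $\mathcal O(w,v,u)=\bar{\mathcal O}(w,v)+\beta^\top(v-\sigma(u))$. Problem (PP): minimize $\mathcal O(w,v,u)$ over $\Omega_2=\{(w,b,v,u): v-u\ge0,\ v-\alpha u\ge 0,\ u=\Psi(v)w+Ab\}$. Limiting stationarity. A point $\bar z\in\mathcal Z$ is a limiting stationary point of $\min_{z\in\mathcal Z}f(z)$ if $0\in\partial f(\bar z)+\mathcal N_{\mathcal Z}(\bar z)$, with $\partial f$ the limiting (Mordukhovich) subdifferential and $\mathcal N_{\mathcal Z}$ the limiting normal cone. For (PP), $\mathcal O$ is regarded as a function of $(w,b,v,u)$. KKT points. Let $\mathcal C(v,u)=\binom{u-v}{\alpha u-v}\in\mathbb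 R^{2m}$. $(w^*,b^*,v^*,u^* )$ is a KKT point of (PP) if there exist $\mu\in\mathbb R^{2m}_+$ and $\xi\in\mathbb R^m$ with $$0\in\partial\mathcal R_1(w^* )-\Psi(v^* )^\top\xi,\qquad 0=A^\top\xi,$$ $$0=\nabla_v\bar{\mathcal O}(w^*,v^* )+\beta+\nabla_v\big(\mu^\top\mathcal C(v,u^* )\big)\big|_{v=v^*}-\nabla_v\big(\xi^\top\Psi(v)w^*\big)\big|_{v=v^*},$$ $$0\in\partial_u\big(-\beta^\top\sigma(u)\big)\big|_{u=u^*}+\nabla_u\big(\mu^\top\mathcal C(v^*,u)\big)\big|_{u=u^*}+\xi,$$ $$\mathcal C(v^*,u^* )\le0,\quad\mu^\top\mathcal C(v^*,u^* )=0,\quad u^*-\Psi(v^* )w^*-Ab^*=0,$$ where $\partial$ is the limiting subdifferential. *)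

(* Defs.v *)
From HB Require Import structures.
From mathcomp Require Import all_boot all_order all_algebra.
From mathcomp Require Import all_classical all_reals all_analysis.
From mathcomp Require Import mxtens.

Set Implicit Arguments.
Unset Strict Implicit.
Unset Printing Implicit Defensive.

Import Order.TTheory GRing.Theory Num.Theory.
Import numFieldNormedType.Exports.

Local Open Scope classical_set_scope.
Local Open Scope ring_scope.

(* The library norm `|x| of a column vector is the sup norm; it is used below
   only through the topology it induces. *)
Section Euclidean.
Context {R : realType} {n : nat}.

Definition dot (x y : 'cV[R]_n) : R := (x^T *m y) 0 0.

Definition enorm (x : 'cV[R]_n) : R := Num.sqrt (dot x x).

Definition mxle (x y : 'cV[R]_n) : Prop := forall i, x i 0 <= y i 0.

Definition grad (f : 'cV[R]_n -> R) (x : 'cV[R]_n) : 'cV[R]_n :=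
  \col_i 'D_(delta_mx i 0) f x.

(* Frechet subdifferential:
   f z >= f x + <g, z - x> - o(|| z - x ||) as z --> x. *)
Definition regular_subdiff (f : 'cV[R]_n -> R) (x : 'cV[R]_n) :
    set 'cV[R]_n :=
  [set g | forall e : R, 0 < e ->
    \forall z \near x, f x + dot g (z - x) - e * enorm (z - x) <= f z].

Definition limiting_subdiff (f : 'cV[R]_n -> R) (x : 'cV[R]_n) :
    set 'cV[R]_n :=
  [set g | exists z_ h_ : nat -> 'cV[R]_n,
    [/\ z_ @ \oo --> x, (f \o z_) @ \oo --> f x,
        forall k, regular_subdiff f (z_ k) (h_ k) & h_ @ \oo --> g]].

(* Frechet normal cone at a point x of Z. *)
Definition regular_normal (Z : set 'cV[R]_n) (x : 'cV[R]_n) : set 'cV[R]_n :=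
  [set g | forall e : R, 0 < e ->
    \forall z \near x, Z z -> dot g (z - x) <= e * enorm (z - x)].

Definition limiting_normal (Z : set 'cV[R]_n) (x : 'cV[R]_n) : set 'cV[R]_n :=
  [set g | exists z_ h_ : nat -> 'cV[R]_n,
    [/\ forall k, Z (z_ k), z_ @ \oo --> x,
        forall k, regular_normal Z (z_ k) (h_ k) & h_ @ \oo --> g]].

Definition limiting_stationary (f : 'cV[R]_n -> R) (Z : set 'cV[R]_n)
    (x : 'cV[R]_n) : Prop :=
  Z x /\ exists g h,
    [/\ limiting_subdiff f x g, limiting_normal Z x h & 0 = g + h].

End Euclidean.

(* Inverse of the column-wise vectorization of a p x q matrix. *)
Definition unvec {R : realType} {p q : nat} (x : 'cV[R]_(q * p)) :
    'M[R]_(p, q) :=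
  \matrix_(i, j) x (mxtens_index (j, i)) 0.

(* Block diagonal matrix with rectangular diagonal blocks: conform_mx only
   transports B i from the type 'M_(p i, q i) to 'M_(p i, q j) when i = j. *)
Definition rect_mxdiag {R : realType} {L : nat} {p q : 'I_L -> nat}
    (B : forall l, 'M[R]_(p l, q l)) : 'M[R]_((\sum_(l < L) p l)%N, (\sum_(l < L) q l)%N) :=
  \mxblock_(i, j) (if i == j then conform_mx (0 : 'M[R]_(p i, q j)) (B i) else 0).

(* Widths are given by d : nat -> nat (only d 0, ..., d L are relevant), and
   l : 'I_L stands for the layer l.+1, whose weight matrix has size
   d l.+1 x d l.  Block l of w is the column-wise vectorization of that matrix;
   block l of v (or u) stacks v_(1,l.+1), ..., v_(N,l.+1), i.e. it is the
   column-wise vectorization of V_(l.+1). *)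
Notation wdim d L := (\sum_(l < L) d (nat_of_ord l) * d (nat_of_ord l).+1)%N.
Notation bdim d L := (\sum_(l < L) d (nat_of_ord l).+1)%N.
Notation vdim N d L := (\sum_(l < L) N * d (nat_of_ord l).+1)%N.

Section Network.
Context {R : realType} {L N : nat} {d : nat -> nat}.

Implicit Types (w : 'cV[R]_(wdim d L)) (b : 'cV[R]_(bdim d L)).
Implicit Types (v u : 'cV[R]_(vdim N d L)).

Definition W_ w (l : 'I_L) : 'M[R]_(d l.+1, d l) := unvec (submxcol w l).

Variable x : 'I_N -> 'cV[R]_(d 0%N).
Variable y : 'I_N -> 'cV[R]_(d L).
Variables (alpha lambdaw lambdav : R) (beta : 'I_L -> R).

(* V_l = (v_(1,l), ..., v_(N,l)) for 0 <= l <= L, with V_0 = (x_1, ..., x_N);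
   the value for l > L is irrelevant. *)
Definition V_ v (l : nat) : 'M[R]_(d l, N) :=
  match l return 'M[R]_(d l, N) with
  | 0 => \matrix_(i, n) x n i 0
  | k.+1 => match (k < L)%N =P true with
            | ReflectT kL => unvec (submxcol v (Ordinal kL))
            | ReflectF _ => 0
            end
  end.

Definition Psi v : 'M[R]_(vdim N d L, wdim d L) :=
  rect_mxdiag (fun l : 'I_L => tensmx (V_ v l)^T (1%:M : 'M[R]_(d l.+1))).

(* The cast only identifies the width 1 * d l.+1 with d l.+1. *)
Definition A_ : 'M[R]_(vdim N d L, bdim d L) :=
  rect_mxdiag (fun l : 'I_L =>
    castmx (erefl, mul1n (d l.+1))
      (tensmx (const_mx 1 : 'cV[R]_N) (1%:M : 'M[R]_(d l.+1)))).

Definition sigma n (z : 'cV[R]_n) : 'cV[R]_n :=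
  map_mx (fun t => Num.max t (alpha * t)) z.

Definition betavec : 'cV[R]_(vdim N d L) :=
  \mxcol_(l < L) (const_mx (beta l) : 'cV[R]_(N * d l.+1)).

Definition R1 w : R :=
  lambdaw * \sum_(l < L) \sum_(j < d l) enorm (col j (W_ w l)).

Definition R2 v : R := lambdav * enorm v ^+ 2.

Definition Obar w v : R :=
  N%:R^-1 * \sum_(n < N) enorm (col n (V_ v L) - y n) ^+ 2 + R1 w + R2 v.

Definition obj w v u : R := Obar w v + dot betavec (v - sigma u).

Definition feasible w b v u : Prop :=
  [/\ mxle 0 (v - u), mxle 0 (v - alpha *: u) & u = Psi v *m w + A_ *m b].

(* Concatenation of the four variables into one vector, and its components. *)
Local Notation zvec :=
  'cV[R]_(wdim d L + (bdim d L + (vdim N d L + vdim N d L))).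

Definition pack w b v u : zvec := col_mx w (col_mx b (col_mx v u)).
Definition wpart (z : zvec) := usubmx z.
Definition bpart (z : zvec) := usubmx (dsubmx z).
Definition vpart (z : zvec) := usubmx (dsubmx (dsubmx z)).
Definition upart (z : zvec) := dsubmx (dsubmx (dsubmx z)).

Definition PP_obj (z : zvec) : R := obj (wpart z) (vpart z) (upart z).

Definition Omega2 : set zvec :=
  [set z | feasible (wpart z) (bpart z) (vpart z) (upart z)].

Definition Cmap v u : 'cV[R]_(vdim N d L + vdim N d L) :=
  col_mx (u - v) (alpha *: u - v).

Definition KKT_point w b v u : Prop :=
  exists (mu : 'cV[R]_(vdim N d L + vdim N d L)) (xi : 'cV[R]_(vdim N d L)),
    [/\ mxle 0 mu,
        exists2 g, limiting_subdiff R1 w g & 0 = g - (Psi v)^T *m xi,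
        0 = A_^T *m xi,
        0 = grad (fun v' => Obar w v') v + betavec
            + grad (fun v' => dot mu (Cmap v' u)) v
            - grad (fun v' => dot xi (Psi v' *m w)) v &
    [/\ exists2 h, limiting_subdiff (fun u' => - dot betavec (sigma u')) u h &
          0 = h + grad (fun u' => dot mu (Cmap v u')) u + xi,
        mxle (Cmap v u) 0,
        dot mu (Cmap v u) = 0 &
        u - Psi v *m w - A_ *m b = 0]].

End Network.

(* Main.v *)
Require Import Defs.
From HB Require Import structures.
From mathcomp Require Import all_boot all_order all_algebra.
From mathcomp Require Import all_classical all_reals all_analysis.
From mathcomp Require Import ring lra mxtens.

(** The feasible set is cut out by [u = Psi v *m w + A b] and the two families
    [u <= v], [alpha u <= v].  It need not be convex, since [Psi v *m w] is
    bilinear, but it satisfies a constraint qualification uniformly: lowering every bias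
    by [eps] lowers [u] by [eps] in each coordinate, because the rows of [A] sum
    to one, and hence makes every active inequality strict to first order.
    Dually, multipliers of a vanishing normal satisfy
    [xi = - (mu1 + alpha mu2) <= 0] and [A^T xi = 0], which forces all of them
    to vanish.

    The limiting normal cone is therefore the cone of Lagrange multiplier
    combinations ([limiting_normal_feas_set]).  In one direction, a direction
    which is strictly feasible for the linearized constraints is the velocity
    of a parabola inside the feasible set ([regular_normal_strict]), so regular
    normals have nonpositive product with it.  Strict linearized feasibility
    persists at nearby points, so limiting normals inherit this inequality
    ([limiting_normal_strict]); the bias perturbation extends it to all
    linearized-feasible directions ([limiting_normal_polar]), and Farkas' lemma
    turns it into multipliers.  In the other direction, along the feasible set
    the Lagrangian identity is exact up to the second-order term
    [DPsi dv *m dw] ([multipliers_regular_normal]).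

    The objective is a separable sum of [R1] in [w], the zero function in [b], a
    convex quadratic in [v] and a continuous function of [u].  The limiting
    subdifferential of such a sum of continuous functions is the product of the
    limiting subdifferentials ([limiting_subdiff_sep_sum]), and for the
    quadratic block it is the gradient ([limiting_subdiff_quadratic]).
    Equating [g + h] to zero block by block, with [g] a subgradient of the
    objective and [h] a normal vector, gives precisely the four stationarity
    equations of a KKT point. *)

Set Implicit Arguments.
Unset Strict Implicit.
Unset Printing Implicit Defensive.

Import Order.TTheory GRing.Theory Num.Theory.
Import numFieldNormedType.Exports.

Local Open Scope classical_set_scope.
Local Open Scope ring_scope.

(** * Euclidean geometry and convergence of column vectors *)

Section Euclid.
Context {R : realType}.

Lemma dotE n (x y : 'cV[R]_n) : dot x y = \sum_i x i 0 * y i 0.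
Proof. by rewrite /dot mxE; apply: eq_bigr => i _; rewrite mxE. Qed.

Lemma dotC n (x y : 'cV[R]_n) : dot x y = dot y x.
Proof. by rewrite !dotE; apply: eq_bigr => i _; rewrite mulrC. Qed.

Lemma dotDr n (x y z : 'cV[R]_n) : dot x (y + z) = dot x y + dot x z.
Proof. by rewrite /dot mulmxDr mxE. Qed.

Lemma dotZr n a (x y : 'cV[R]_n) : dot x (a *: y) = a * dot x y.
Proof. by rewrite /dot -scalemxAr mxE. Qed.

Lemma dotNr n (x y : 'cV[R]_n) : dot x (- y) = - dot x y.
Proof. by rewrite -scaleN1r dotZr mulN1r. Qed.

Lemma dotDl n (x y z : 'cV[R]_n) : dot (x + y) z = dot x z + dot y z.
Proof. by rewrite ![dot _ z]dotC dotDr. Qed.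

Lemma dotZl n a (x y : 'cV[R]_n) : dot (a *: x) y = a * dot x y.
Proof. by rewrite ![dot _ y]dotC dotZr. Qed.

Lemma dotNl n (x y : 'cV[R]_n) : dot (- x) y = - dot x y.
Proof. by rewrite ![dot _ y]dotC dotNr. Qed.

Lemma dot0r n (x : 'cV[R]_n) : dot x 0 = 0.
Proof. by rewrite /dot mulmx0 mxE. Qed.

Lemma dot_mulmxr m n (M : 'M[R]_(m, n)) x y :
  dot x (M *m y) = dot (M^T *m x) y.
Proof. by rewrite /dot trmx_mul trmxK mulmxA. Qed.

Lemma dot_col_mx m n (x x' : 'cV[R]_m) (y y' : 'cV[R]_n) :
  dot (col_mx x y) (col_mx x' y') = dot x x' + dot y y'.
Proof. by rewrite /dot tr_col_mx mul_row_col mxE. Qed.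

Lemma dot_delta n (x : 'cV[R]_n) i : dot x (delta_mx i 0) = x i 0.
Proof.
rewrite dotE (bigD1 i) //= mxE !eqxx mulr1 big1 ?addr0// => j ji.
by rewrite mxE (negPf ji) mulr0.
Qed.

Lemma dot_eqP n (x y : 'cV[R]_n) : (forall h, dot x h = dot y h) -> x = y.
Proof.
by move=> xy; apply/colP => i; rewrite -(dot_delta x) -(dot_delta y) xy.
Qed.

Lemma dot_ge0 n (x : 'cV[R]_n) : 0 <= dot x x.
Proof. by rewrite dotE sumr_ge0// => i _; rewrite -expr2 sqr_ge0. Qed.

Lemma enorm_ge0 n (x : 'cV[R]_n) : 0 <= enorm x.
Proof. exact: sqrtr_ge0. Qed.

Lemma enorm_sqr n (x : 'cV[R]_n) : enorm x ^+ 2 = dot x x.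
Proof. by rewrite sqr_sqrtr// dot_ge0. Qed.

Lemma enormZ n t (x : 'cV[R]_n) : 0 <= t -> enorm (t *: x) = t * enorm x.
Proof.
move=> t0; rewrite /enorm dotZr dotZl mulrA -expr2 sqrtrM ?sqr_ge0//.
by rewrite sqrtr_sqr ger0_norm.
Qed.

Lemma coord_le_enorm n (x : 'cV[R]_n) i : `|x i 0| <= enorm x.
Proof.
rewrite -sqrtr_sqr ler_wsqrtr// dotE (bigD1 i) //= -expr2 lerDl.
by rewrite sumr_ge0// => j _; rewrite -expr2 sqr_ge0.
Qed.

Lemma enorm_col_mx_ge m n (x : 'cV[R]_m) (y : 'cV[R]_n) :
  enorm x <= enorm (col_mx x y) /\ enorm y <= enorm (col_mx x y).
Proof.
by split; rewrite ler_wsqrtr// dot_col_mx ?lerDl ?lerDr dot_ge0.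
Qed.

Lemma enorm_col_mx0 m n (x : 'cV[R]_m) : enorm (col_mx x (0 : 'cV_n)) = enorm x.
Proof. by rewrite /enorm dot_col_mx dot0r addr0. Qed.

Lemma enorm_col_0mx m n (x : 'cV[R]_m) : enorm (col_mx (0 : 'cV_n) x) = enorm x.
Proof. by rewrite /enorm dot_col_mx dot0r add0r. Qed.

(** A crude form of the Cauchy-Schwarz inequality; it suffices for making
    [dot x y] small relative to [enorm y] when the coordinates of [x] are
    small. *)
Lemma dot_le_sum_enorm n (x y : 'cV[R]_n) :
  dot x y <= (\sum_i `|x i 0|) * enorm y.
Proof.
rewrite dotE mulr_suml ler_sum// => i _.
by rewrite (le_trans (ler_norm _))// normrM ler_wpM2l// coord_le_enorm.
Qed.

Lemma le0_of_le_eps (a c : R) : (forall e, 0 < e -> a <= e * c) -> a <= 0.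
Proof.
move=> ac; have [c0|c0] := lerP c 0.
  by apply: le_trans (ac 1 ltr01) _; rewrite mul1r.
apply/ler_addgt0Pr => e e0; rewrite add0r.
by have := ac (e / c) (divr_gt0 e0 c0); rewrite divfK// gt_eqF.
Qed.

Section Cvg.
Context {T : Type} {F : set_system T} {FF : Filter F}.

Lemma cvg_mx m n (f : T -> 'M[R]_(m, n)) (a : 'M[R]_(m, n)) :
  (forall i j, (fun t => f t i j) @ F --> a i j) -> f @ F --> a.
Proof.
move=> fa A /= [P aP PA].
apply: (@filterS _ F _ (fun t => forall i j, P i j (f t i j))).
  by move=> t Pt; exact: PA.
by apply: filter_forall => i; apply: filter_forall => j; exact: fa.
Qed.

Lemma cvg_coord m n (f : T -> 'M[R]_(m, n)) (a : 'M[R]_(m, n)) i j :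
  f @ F --> a -> (fun t => f t i j) @ F --> a i j.
Proof.
move=> fa.
apply: (@continuous_cvg _ _ _ F FF f (fun M : 'M[R]_(m, n) => M i j)) fa.
exact: coord_continuous.
Qed.

Lemma cvg_sum_ord n (f : 'I_n -> T -> R) (a : 'I_n -> R) :
  (forall i, f i @ F --> a i) ->
  (fun t => \sum_i f i t) @ F --> \sum_i a i.
Proof. by move=> fa; apply: cvg_big => //; exact: add_continuous. Qed.

Lemma cvg_dot n (f g : T -> 'cV[R]_n) (a b : 'cV[R]_n) :
  f @ F --> a -> g @ F --> b -> (fun t => dot (f t) (g t)) @ F --> dot a b.
Proof.
move=> fa gb; rewrite dotE; under eq_fun do rewrite dotE.
by apply: cvg_sum_ord => i; apply: cvgM; exact: cvg_coord.
Qed.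

Lemma cvg_enorm n (f : T -> 'cV[R]_n) (a : 'cV[R]_n) :
  f @ F --> a -> (fun t => enorm (f t)) @ F --> enorm a.
Proof.
move=> fa.
apply: (@continuous_cvg _ _ _ F FF (fun t => dot (f t) (f t)) Num.sqrt).
  exact: sqrt_continuous.
exact: cvg_dot.
Qed.

Lemma cvg_usubmx m n (f : T -> 'cV[R]_(m + n)) (a : 'cV[R]_(m + n)) :
  f @ F --> a -> (fun t => usubmx (f t)) @ F --> usubmx a.
Proof.
move=> fa; apply: cvg_mx => i j; rewrite mxE; under eq_fun do rewrite mxE.
exact: cvg_coord.
Qed.

Lemma cvg_dsubmx m n (f : T -> 'cV[R]_(m + n)) (a : 'cV[R]_(m + n)) :
  f @ F --> a -> (fun t => dsubmx (f t)) @ F --> dsubmx a.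
Proof.
move=> fa; apply: cvg_mx => i j; rewrite mxE; under eq_fun do rewrite mxE.
exact: cvg_coord.
Qed.

Lemma cvg_col_mx m n (f : T -> 'cV[R]_m) (g : T -> 'cV[R]_n)
    (a : 'cV[R]_m) (b : 'cV[R]_n) :
  f @ F --> a -> g @ F --> b ->
  (fun t => col_mx (f t) (g t)) @ F --> col_mx a b.
Proof.
move=> fa gb; apply: cvg_mx => i j; rewrite mxE; under eq_fun do rewrite mxE.
by case: (fintype.split i) => k; exact: cvg_coord.
Qed.

Lemma cvg_mulmx m n k (f : T -> 'M[R]_(m, n)) (g : T -> 'M[R]_(n, k))
    (a : 'M[R]_(m, n)) (b : 'M[R]_(n, k)) :
  f @ F --> a -> g @ F --> b -> (fun t => f t *m g t) @ F --> a *m b.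
Proof.
move=> fa gb; apply: cvg_mx => i j; rewrite mxE; under eq_fun do rewrite mxE.
by apply: cvg_sum_ord => l; apply: cvgM; exact: cvg_coord.
Qed.

Lemma cV_sum_delta n (x : 'cV[R]_n) : x = \sum_i x i 0 *: delta_mx i 0.
Proof.
by rewrite {1}[x]matrix_sum_delta; apply: eq_bigr => i _; rewrite big_ord1.
Qed.

Lemma cvg_linear_mx m n k (phi : {linear 'cV[R]_n -> 'M[R]_(m, k)})
    (f : T -> 'cV[R]_n) (a : 'cV[R]_n) :
  f @ F --> a -> (fun t => phi (f t)) @ F --> phi a.
Proof.
have phiE x : phi x = \sum_i x i 0 *: phi (delta_mx i 0).
  rewrite {1}[x]cV_sum_delta linear_sum.
  by apply: eq_bigr => i _; rewrite linearZ.
move=> fa; apply: cvg_mx => i j; rewrite phiE summxE.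
under eq_fun do rewrite phiE summxE.
apply: cvg_sum_ord => l; rewrite mxE; under eq_fun do rewrite mxE.
by apply: cvgM; [exact: cvg_coord | exact: cvg_cst].
Qed.

End Cvg.
End Euclid.

Lemma continuous_of_cvg (R : realType) n (f : 'cV[R]_n -> R) :
  (forall T (F : set_system T) (FF : Filter F) (x_ : T -> 'cV[R]_n) x,
     x_ @ F --> x -> (fun t => f (x_ t)) @ F --> f x) ->
  continuous f.
Proof. by move=> f_cvg x; apply: (f_cvg _ (nbhs x) _ id); apply: cvg_id. Qed.

(** * First-order behaviour along curves *)

Section Curves.
Context {R : realType} {n : nat}.
Implicit Types (x d r g : 'cV[R]_n) (f : 'cV[R]_n -> R) (Z : set 'cV[R]_n).

Lemma cvg_curve0 x d r :
  (fun t : R => x + t *: (d + t *: r)) @ 0^'+ --> x.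
Proof.
have t0 : (fun t : R => t) @ 0^'+ --> (0 : R) by exact: cvg_at_right_filter.
have : (fun t : R => x + t *: (d + t *: r)) @ 0^'+ --> x + 0 *: (d + 0 *: r).
  apply: cvgD; first exact: cvg_cst.
  apply: cvgZ => //; apply: cvgD; first exact: cvg_cst.
  by apply: cvgZr_tmp.
by rewrite scale0r addr0.
Qed.

(** The curve [x + t d + t^2 r] has velocity [d] at [x], and the term
    [t^2 r] is absorbed by the Frechet error. *)
Lemma regular_normal_curve Z x g d r :
  regular_normal Z x g ->
  (\forall t \near (0 : R)^'+, Z (x + t *: (d + t *: r))) -> dot g d <= 0.
Proof.
move=> gN Zx; apply: (@le0_of_le_eps R _ (enorm d)) => e e0.
have dr : (fun t : R => d + t *: r) @ 0^'+ --> d.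
  have -> : (fun t : R => d + t *: r) = (fun t : R => d + t *: (r + t *: 0)).
    by apply/funext => t; rewrite scaler0 addr0.
  exact: cvg_curve0.
have := @cvg_curve0 x d r; move=> /(_ _ (gN e e0)) /= near_x.
apply: (@ler_cvg_to _ (0 : R)^'+ _ R (fun t => dot g (d + t *: r))
          (fun t => e * enorm (d + t *: r))).
- by apply: cvg_dot => //; exact: cvg_cst.
- by apply: cvgM; [exact: cvg_cst | exact: cvg_enorm].
near=> t.
have t0 : 0 < t by near: t; exact: nbhs_right_gt.
have : dot g (x + t *: (d + t *: r) - x) <=
    e * enorm (x + t *: (d + t *: r) - x).
  by have : Z (x + t *: (d + t *: r)) by [near: t]; near: t.
rewrite addrC addKr dotZr enormZ; last exact: ltW.
by rewrite mulrCA ler_pM2l.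
Unshelve. all: by end_near. Qed.

Lemma regular_subdiff_dir f x g h l q :
  regular_subdiff f x g ->
  (forall t, f (x + t *: h) = f x + t * l + t ^+ 2 * q) -> dot g h <= l.
Proof.
move=> gf fE; rewrite -subr_le0.
apply: (@le0_of_le_eps R _ (enorm h)) => e e0.
have := @cvg_curve0 x h 0; move=> /(_ _ (gf e e0)) /= near_x.
apply: (@ler_cvg_to _ (0 : R)^'+ _ R (fun=> dot g h - l)
          (fun t => e * enorm h + t * q)).
- exact: cvg_cst.
- rewrite -[X in _ --> X]addr0 -[X in _ --> _ + X](mul0r q).
  apply: cvgD; first exact: cvg_cst.
  by apply: cvgM; [exact: cvg_at_right_filter | exact: cvg_cst].
near=> t.
have t0 : 0 < t by near: t; exact: nbhs_right_gt.
have : f x + dot g (x + t *: (h + t *: 0) - x) -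
    e * enorm (x + t *: (h + t *: 0) - x) <= f (x + t *: (h + t *: 0)).
  by near: t.
rewrite scaler0 addr0 [x + _ - x]addrC addKr dotZr enormZ; last exact: ltW.
rewrite fE => le_t; rewrite -(ler_pM2l t0); nra.
Unshelve. all: by end_near. Qed.

End Curves.

(** * Quadratic functions *)

Section Quadratic.
Context {R : realType} {n : nat}.
Implicit Types (x h g : 'cV[R]_n) (f : 'cV[R]_n -> R).

Variables (f : 'cV[R]_n -> R) (D : 'cV[R]_n -> 'cV[R]_n -> R).
Variable (Q : 'cV[R]_n -> R).
Hypothesis fE : forall x t h, f (x + t *: h) = f x + t * D x h + t ^+ 2 * Q h.
Hypothesis Dlin : forall x, linear (D x : _ -> R^o).

Lemma derive_quadratic x h : 'D_h f x = D x h.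
Proof.
rewrite /derive; apply: cvg_lim => //.
have lim0 : (fun t : R => D x h + t * Q h) @ 0^' --> D x h.
  rewrite -[X in _ --> X]addr0 -[X in _ --> _ + X](mul0r (Q h)).
  apply: cvgD; first exact: cvg_cst.
  apply: cvgM; last exact: cvg_cst.
  by apply: cvg_within_filter; exact: cvg_id.
apply: cvg_trans lim0; apply: near_eq_cvg; near=> t.
have t0 : t != 0 by near: t; exact: nbhs_dnbhs_neq.
rewrite /= [_ *: h + x]addrC fE -[_ *: (_ - _)]/(_ * _).
by field.
Unshelve. all: by end_near. Qed.

Lemma dot_grad_quadratic x h : dot (grad f x) h = D x h.
Proof.
rewrite dotE [in RHS](cV_sum_delta h).
have -> : D x (\sum_i h i 0 *: delta_mx i 0) =
    \sum_i h i 0 * D x (delta_mx i 0).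
  pose Dx := GRing.isLinear.Build _ _ _ _ _ (Dlin x).
  pose DL : {linear 'cV[R]_n -> R^o} := HB.pack (D x : _ -> R^o) Dx.
  rewrite -[D x]/(DL : _ -> R^o) linear_sum; apply: eq_bigr => i _.
  by rewrite linearZ.
by apply: eq_bigr => i _; rewrite mxE derive_quadratic mulrC.
Qed.

(** Testing a subgradient along [h] and [- h] forces equality with the
    derivative; conversely [0 <= Q] is convexity, which makes the gradient
    inequality global. *)
Lemma regular_subdiff_quadratic x g :
  (forall h, 0 <= Q h) -> regular_subdiff f x g <-> g = grad f x.
Proof.
move=> Q0; split=> [gf|->].
  apply/dot_eqP => h; rewrite dot_grad_quadratic; apply/eqP.
  rewrite eq_le (regular_subdiff_dir gf (fun t => fE x t h))/=.
  have : dot g (- h) <= - D x h.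
    apply: (regular_subdiff_dir (q := Q h) gf) => t.
    by rewrite scalerN -scaleNr fE sqrrN mulNr mulrN.
  by rewrite dotNr lerN2.
move=> e e0; apply: (@filterE _ (nbhs x)) => z.
rewrite -[in leRHS](subrK x z) [z - x + x]addrC -[z - x]scale1r fE !scale1r.
rewrite dot_grad_quadratic expr1n !mul1r.
by have := mulr_ge0 (ltW e0) (enorm_ge0 (z - x)); have := Q0 (z - x); lra.
Qed.

(** The limiting subdifferential adds nothing to the gradient because the
    gradient is continuous. *)
Lemma limiting_subdiff_quadratic x g :
  (forall h, 0 <= Q h) -> (forall h, continuous (fun x => D x h)) ->
  limiting_subdiff f x g <-> g = grad f x.
Proof.
move=> Q0 Dcont; split=> [[z_ [g_ [zx _ gz gg]]]|->].
  apply/dot_eqP => h; rewrite dot_grad_quadratic.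
  have gh : (fun k => dot (g_ k) h) @ \oo --> dot g h.
    by apply: cvg_dot => //; exact: cvg_cst.
  have Dh : (fun k => D (z_ k) h) @ \oo --> D x h.
    by apply: (@continuous_cvg _ _ _ _ _ _ (fun x => D x h)) => //; exact: Dcont.
  have gD : (fun k => dot (g_ k) h) = (fun k => D (z_ k) h).
    apply/funext => k; have /regular_subdiff_quadratic -> // := gz k.
    exact: dot_grad_quadratic.
  by rewrite gD in gh; exact: (cvg_unique _ gh Dh).
exists (fun=> x), (fun=> grad f x); split; try exact: cvg_cst.
by move=> _; apply/regular_subdiff_quadratic.
Qed.

End Quadratic.

Lemma grad_affine (R : realType) n (f : 'cV[R]_n -> R) (g z : 'cV[R]_n) :
  (forall (z h : 'cV[R]_n) t, f (z + t *: h) = f z + t * dot g h) ->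
  grad f z = g.
Proof.
move=> fE; apply/dot_eqP => h.
rewrite (@dot_grad_quadratic _ _ _ (fun _ => dot g) (fun=> 0)) //.
  by move=> z' t h'; rewrite fE mulr0 addr0.
by move=> _ k h1 h2; rewrite dotDr dotZr.
Qed.

(** * Separable sums *)

Section Separable.
Context {R : realType} {m n : nat}.
Variables (f : 'cV[R]_m -> R) (g : 'cV[R]_n -> R).

Definition sep_sum (z : 'cV[R]_(m + n)) : R := f (usubmx z) + g (dsubmx z).

Lemma regular_subdiff_sep_sum x y a b :
  regular_subdiff sep_sum (col_mx x y) (col_mx a b) <->
  regular_subdiff f x a /\ regular_subdiff g y b.
Proof.
split=> [fg|[fx gy]].
  split=> e e0.
    have xy : (fun z => col_mx z y) @ nbhs x --> col_mx x y.
      by apply: cvg_col_mx; [apply: cvg_id | exact: cvg_cst].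
    move: xy => /(_ _ (fg e e0)) /=; apply: (@filterS _ (nbhs x)) => z.
    rewrite /sep_sum /= !col_mxKu !col_mxKd opp_col_mx add_col_mx subrr.
    by rewrite dot_col_mx enorm_col_mx0 dot0r; lra.
  have xy : (fun z => col_mx x z) @ nbhs y --> col_mx x y.
    by apply: cvg_col_mx; [exact: cvg_cst | apply: cvg_id].
  move: xy => /(_ _ (fg e e0)) /=; apply: (@filterS _ (nbhs y)) => z.
  rewrite /sep_sum /= !col_mxKu !col_mxKd opp_col_mx add_col_mx subrr.
  by rewrite dot_col_mx enorm_col_0mx dot0r; lra.
move=> e e0; have e20 : 0 < e / 2 by lra.
have ux : (fun z : 'cV[R]_(m + n) => usubmx z) @ nbhs (col_mx x y) --> x.
  by rewrite -[X in _ --> X](col_mxKu x y); apply: cvg_usubmx; apply: cvg_id.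
have dy : (fun z : 'cV[R]_(m + n) => dsubmx z) @ nbhs (col_mx x y) --> y.
  by rewrite -[X in _ --> X](col_mxKd x y); apply: cvg_dsubmx; apply: cvg_id.
move: ux dy => /(_ _ (fx _ e20)) /= nearx /(_ _ (gy _ e20)) /= neary.
apply: (@filterS2 _ (nbhs (col_mx x y)) _ _ _ _ _ nearx neary) => z /= fz gz.
rewrite /sep_sum col_mxKu col_mxKd -[in dot _ _](vsubmxK z).
rewrite -[in enorm _](vsubmxK z) opp_col_mx add_col_mx dot_col_mx.
have [] := enorm_col_mx_ge (usubmx z - x) (dsubmx z - y).
by move: fz gz; nra.
Qed.

(** Continuity makes the attentiveness requirement (convergence of the
    function values along the approximating sequence) automatic for each
    summand separately. *)
Lemma limiting_subdiff_sep_sum x y a b : continuous f -> continuous g ->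
  limiting_subdiff sep_sum (col_mx x y) (col_mx a b) <->
  limiting_subdiff f x a /\ limiting_subdiff g y b.
Proof.
move=> fcont gcont; split=> [[z_ [h_ [zz _ hz hh]]]|[]].
  have h_sep k : regular_subdiff f (usubmx (z_ k)) (usubmx (h_ k)) /\
                 regular_subdiff g (dsubmx (z_ k)) (dsubmx (h_ k)).
    by apply/regular_subdiff_sep_sum; rewrite !vsubmxK.
have ux : (fun k => usubmx (z_ k)) @ \oo --> x.
    by rewrite -[X in _ --> X](col_mxKu x y); exact: cvg_usubmx.
  have dy : (fun k => dsubmx (z_ k)) @ \oo --> y.
    by rewrite -[X in _ --> X](col_mxKd x y); exact: cvg_dsubmx.
  split.
    exists (fun k => usubmx (z_ k)), (fun k => usubmx (h_ k)); split=> //.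
    - by apply: continuous_cvg => //; exact: fcont.
    - by move=> k; have [] := h_sep k.
    - by rewrite -[X in _ --> X](col_mxKu a b); exact: cvg_usubmx.
  exists (fun k => dsubmx (z_ k)), (fun k => dsubmx (h_ k)); split=> //.
  - by apply: continuous_cvg => //; exact: gcont.
  - by move=> k; have [] := h_sep k.
  - by rewrite -[X in _ --> X](col_mxKd a b); exact: cvg_dsubmx.
move=> [x_ [a_ [xx fx ax aa]]] [y_ [b_ [yy gy bb bbb]]].
exists (fun k => col_mx (x_ k) (y_ k)), (fun k => col_mx (a_ k) (b_ k)).
split; try exact: cvg_col_mx.
  rewrite /sep_sum col_mxKu col_mxKd /comp.
  by under eq_fun do rewrite col_mxKu col_mxKd; exact: cvgD.
by move=> k; apply/regular_subdiff_sep_sum.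
Qed.

End Separable.

Lemma sep_sum_continuous (R : realType) m n (f : 'cV[R]_m -> R)
    (g : 'cV[R]_n -> R) :
  continuous f -> continuous g -> continuous (sep_sum f g).
Proof.
move=> fc gc; apply: continuous_of_cvg => T F FF z_ z zz.
apply: cvgD; apply: continuous_cvg.
- exact: fc.
- exact: cvg_usubmx.
- exact: gc.
- exact: cvg_dsubmx.
Qed.

(** * Farkas' lemma *)

(** Bartl's induction on the number of inequalities.  If the first one is not
    implied, some [x0] satisfies all the others and has [0 < c x0], hence
    [0 < f ord0 x0]; projecting along [x0] onto the kernel of [f ord0] reduces
    to the remaining inequalities, and the multiplier of [f ord0] is then
    determined by the value at [x0]. *)
Lemma farkas (R : realFieldType) (W : lmodType R) m
    (f : 'I_m -> {linear W -> R^o}) (c : {linear W -> R^o}) :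
  (forall x, (forall i, f i x <= 0) -> c x <= 0) ->
  exists2 mu : 'I_m -> R, forall i, 0 <= mu i &
    forall x, c x = \sum_i mu i * f i x.
Proof.
elim: m f c => [|m IH] f c fc.
  exists (fun=> 0) => [[]//|x]; rewrite big_ord0; apply/eqP.
  rewrite eq_le fc /=; last by case.
  by rewrite -oppr_le0 -(linearN c) fc //; case.
pose f' i := f (lift ord0 i).
have [red|] := pselect (forall x, (forall i, f' i x <= 0) -> c x <= 0).
  have [mu mu0 cE] := IH f' c red.
  exists (fun i => oapp mu 0 (unlift ord0 i)) => [i|x].
    by case: unliftP => [j _|_] /=.
  rewrite big_ord_recl unlift_none mul0r add0r cE.
  by apply: eq_bigr => i _; rewrite liftK.
move=> /existsNP[x0 /not_implyP[f'x0 /negP]]; rewrite -ltNge => cx0.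
have f0x0 : 0 < f ord0 x0.
  rewrite ltNge; apply/negP => f0x0; suff : c x0 <= 0 by rewrite leNgt cx0.
  by apply: fc => i; case: (unliftP ord0 i) => [j|] ->//; exact: f'x0.
pose p (h : {linear W -> R^o}) : {linear W -> R^o} :=
  h \- ((h x0 / f ord0 x0) \*: f ord0).
have pE (h : {linear W -> R^o}) x :
    p h x = h (x - (f ord0 x / f ord0 x0) *: x0).
  rewrite linearB linearZ /= /GRing.scale /=; ring.
have [x f'x|mu mu0 cE] := IH (fun i => p (f' i)) (p c).
  rewrite pE; apply: fc => i; case: (unliftP ord0 i) => [j|] ->.
    by rewrite -/(f' j) -pE.
  by rewrite linearB linearZ /= /GRing.scale /= divfK ?subrr ?gt_eqF.
pose mu_0 := (c x0 - \sum_j mu j * f' j x0) / f ord0 x0.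
exists (fun i => oapp mu mu_0 (unlift ord0 i)) => [i|x].
  case: unliftP => [j _|_] //=; apply: divr_ge0; last exact: ltW.
  rewrite subr_ge0 (le_trans _ (ltW cx0))// sumr_le0// => j _.
  by rewrite mulr_ge0_le0.
rewrite big_ord_recl unlift_none.
under eq_bigr do rewrite liftK /=.
rewrite /= /mu_0.
have := cE x; rewrite /p /= /GRing.scale /=.
under eq_bigr do rewrite mulrBr 2!mulrA.
rewrite sumrB -!mulr_suml => /(canRL (subrK _)) ->.
by ring.
Qed.

(** * The feasible set and its normal cone *)

(** One inequality constraint along a parabola: either it has slack at the
    starting point, or the first-order decrease beats the [t^2] term. *)
Lemma near0_le_quadratic (R : realType) (a a' b b' c : R) :
  a <= a' -> a < a' \/ b < b' ->
  \forall t \near 0^'+, a + t * (b + t * c) <= a' + t * b'.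
Proof.
move=> aa'.
have id0 : (fun t : R => t) @ 0^'+ --> (0 : R) by exact: cvg_at_right_filter.
have bc : (fun t : R => b + t * c) @ 0^'+ --> b.
  rewrite -[X in _ --> X]addr0 -[X in _ --> _ + X](mul0r c).
  by apply: cvgD; [exact: cvg_cst | apply: cvgM => //; exact: cvg_cst].
case=> [lt_a|lt_b]; near=> t.
  have : 0 < a' - a + t * (b' - (b + t * c)).
    near: t; apply: (cvgr_gt (a' - a)); last by rewrite subr_gt0.
    rewrite -[X in _ --> X]addr0 -[X in _ --> _ + X](mul0r (b' - b)).
    apply: cvgD; first exact: cvg_cst.
    by apply: cvgM => //; apply: cvgB => //; exact: cvg_cst.
  by lra.
have t0 : 0 < t by near: t; exact: nbhs_right_gt.
have : b + t * c < b' by near: t; exact: (cvgr_lt b).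
by move=> /ltW; rewrite -(ler_pM2l t0); lra.
Unshelve. all: by end_near. Qed.

Lemma near_lt (R : realType) (T : Type) (F : set_system T) {FF : Filter F}
    (f g : T -> R) (a b : R) :
  f @ F --> a -> g @ F --> b -> a < b -> \forall t \near F, f t < g t.
Proof.
move=> fa gb ab; have : (fun t => g t - f t) @ F --> b - a by exact: cvgB.
by move=> /cvgr_gt /(_ 0); rewrite subr_gt0 => /(_ ab); apply: filterS => t;
  rewrite subr_gt0.
Qed.

Section FeasibleSet.
Context {R : realType} {a c p : nat}.
Variables (alpha : R) (Psi : 'cV[R]_p -> 'M[R]_(p, a)).
Variables (DPsi : {linear 'cV[R]_p -> 'M[R]_(p, a)}) (A : 'M[R]_(p, c)).
Hypothesis PsiD : forall v h, Psi (v + h) = Psi v + DPsi h.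
Hypothesis alpha_gt0 : 0 < alpha.
Hypothesis A1 : A *m (const_mx 1 : 'cV[R]_c) = const_mx 1.

Implicit Types (w dw : 'cV[R]_a) (b db : 'cV[R]_c) (v u dv du : 'cV[R]_p).

Local Notation col4 w b v u := (col_mx w (col_mx b (col_mx v u))).

Definition feas w b v u : Prop :=
  [/\ mxle u v, mxle (alpha *: u) v & u = Psi v *m w + A *m b].

Definition feas_set : set 'cV[R]_(a + (c + (p + p))) :=
  [set z | feas (usubmx z) (usubmx (dsubmx z)) (usubmx (dsubmx (dsubmx z)))
                (dsubmx (dsubmx (dsubmx z)))].

Lemma feas_setE w b v u : feas_set (col4 w b v u) = feas w b v u.
Proof. by rewrite /feas_set /= !(col_mxKu, col_mxKd). Qed.

(** The derivative of [Psi v *m w + A *m b] in the direction [(dw, db, dv)]. *)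
Definition lin w v dw db dv := Psi v *m dw + DPsi dv *m w + A *m db.

(** Each constraint is either inactive or strictly decreasing to first order;
    in this disjunctive form both alternatives are open. *)
Definition strict w v u dw db dv := forall i,
  (u i 0 < v i 0 \/ lin w v dw db dv i 0 < dv i 0) /\
  (alpha * u i 0 < v i 0 \/ alpha * lin w v dw db dv i 0 < dv i 0).

(** Along [(w + t dw, b + t db, v + t dv)] the equality constraint determines
    [u] exactly as [u + t lin + t^2 (DPsi dv *m dw)]: the feasible curve is a
    parabola. *)
Lemma regular_normal_strict w b v u eta dw db dv :
  feas w b v u -> strict w v u dw db dv ->
  regular_normal feas_set (col4 w b v u) eta ->
  dot eta (col4 dw db dv (lin w v dw db dv)) <= 0.
Proof.
move=> [uv auv uE] st etaN; set du := lin _ _ _ _ _.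
pose r := DPsi dv *m dw.
apply: (regular_normal_curve (r := col4 0 0 0 r) etaN).
suff : \forall t \near 0^'+, mxle (u + t *: (du + t *: r)) (v + t *: dv) /\
    mxle (alpha *: (u + t *: (du + t *: r))) (v + t *: dv).
  apply: filterS => t [le1 le2].
  rewrite !(scale_col_mx, add_col_mx, scaler0, addr0) feas_setE; split=> //.
  rewrite PsiD linearZ /= mulmxDl !mulmxDr -!scalemxAl -!scalemxAr uE /du /lin.
  by apply/colP => i; rewrite !mxE /=; ring.
suff : \forall t \near 0^'+, forall i,
    (u + t *: (du + t *: r)) i 0 <= (v + t *: dv) i 0 /\
    (alpha *: (u + t *: (du + t *: r))) i 0 <= (v + t *: dv) i 0.
  by apply: filterS => t le_t; split=> i; have [] := le_t i.
apply: filter_forall => i; have [st1 st2] := st i.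
have near1 := near0_le_quadratic (r i 0) (uv i) st1.
have := auv i; rewrite mxE => auvi.
have near2 := near0_le_quadratic (alpha * r i 0) auvi st2.
apply: filterS2 near1 near2 => t; rewrite !mxE -/du => le1 le2; split=> //.
by apply: le_trans le2; lra.
Qed.

Lemma cvg_lin (T : Type) (F : set_system T) {FF : Filter F}
    (w_ : T -> 'cV[R]_a) (v_ : T -> 'cV[R]_p) w v dw db dv :
  w_ @ F --> w -> v_ @ F --> v ->
  (fun t => lin (w_ t) (v_ t) dw db dv) @ F --> lin w v dw db dv.
Proof.
move=> ww vv; have PsiE x : Psi x = Psi 0 + DPsi x by rewrite -PsiD add0r.
apply: cvgD; last exact: cvg_cst.
apply: cvgD; last by apply: cvg_mulmx => //; exact: cvg_cst.
apply: cvg_mulmx; last exact: cvg_cst.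
rewrite PsiE; under eq_fun do rewrite PsiE.
by apply: cvgD; [exact: cvg_cst | exact: cvg_linear_mx].
Qed.

(** [strict] is an open condition on [(w, v, u)], so it holds along the tail of
    the approximating sequence, where [regular_normal_strict] applies to the
    direction with its last component recomputed at the nearby point.  Only this
    scalar inequality, and no sequence of multipliers, has to converge. *)
Lemma limiting_normal_strict w b v u eta dw db dv :
  strict w v u dw db dv -> limiting_normal feas_set (col4 w b v u) eta ->
  dot eta (col4 dw db dv (lin w v dw db dv)) <= 0.
Proof.
move=> st [z_ [h_ [Zz zz hz hh]]].
pose w_ k := usubmx (z_ k); pose b_ k := usubmx (dsubmx (z_ k)).
pose v_ k := usubmx (dsubmx (dsubmx (z_ k))).
pose u_ k := dsubmx (dsubmx (dsubmx (z_ k))).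
have zE k : z_ k = col4 (w_ k) (b_ k) (v_ k) (u_ k) by rewrite !vsubmxK.
have ww : w_ @ \oo --> w.
  have -> : w = usubmx (col4 w b v u) by rewrite col_mxKu.
  exact: cvg_usubmx.
have vv : v_ @ \oo --> v.
  have -> : v = usubmx (dsubmx (dsubmx (col4 w b v u))).
    by rewrite !(col_mxKu, col_mxKd).
  by apply: cvg_usubmx; do 2 apply: cvg_dsubmx.
have uu : u_ @ \oo --> u.
  have -> : u = dsubmx (dsubmx (dsubmx (col4 w b v u))).
    by rewrite !(col_mxKu, col_mxKd).
  by do 3 apply: cvg_dsubmx.
have ll : (fun k => lin (w_ k) (v_ k) dw db dv) @ \oo --> lin w v dw db dv.
  exact: cvg_lin.
have near_st : \forall k \near \oo, strict (w_ k) (v_ k) (u_ k) dw db dv.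
  apply: filter_forall => i; have [st1 st2] := st i.
  have ui : (fun k => u_ k i 0) @ \oo --> u i 0 by exact: cvg_coord.
  have vi : (fun k => v_ k i 0) @ \oo --> v i 0 by exact: cvg_coord.
  have li : (fun k => lin (w_ k) (v_ k) dw db dv i 0) @ \oo -->
      lin w v dw db dv i 0 by exact: cvg_coord.
  have aui : (fun k => alpha * u_ k i 0) @ \oo --> alpha * u i 0.
    by apply: cvgM => //; exact: cvg_cst.
  have ali : (fun k => alpha * lin (w_ k) (v_ k) dw db dv i 0) @ \oo -->
      alpha * lin w v dw db dv i 0.
    by apply: cvgM => //; exact: cvg_cst.
  have cst : (fun=> dv i 0) @ \oo --> dv i 0 by exact: cvg_cst.
  have near1 : \forall k \near \oo, u_ k i 0 < v_ k i 0 \/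
      lin (w_ k) (v_ k) dw db dv i 0 < dv i 0.
    case: st1 => [/(near_lt ui vi)|/(near_lt li cst)].
      by apply: filterS => k; left.
    by apply: filterS => k; right.
  have near2 : \forall k \near \oo, alpha * u_ k i 0 < v_ k i 0 \/
      alpha * lin (w_ k) (v_ k) dw db dv i 0 < dv i 0.
    case: st2 => [/(near_lt aui vi)|/(near_lt ali cst)].
      by apply: filterS => k; left.
    by apply: filterS => k; right.
  by apply: filterS2 near1 near2.
apply: (@cvgr_to_le _ \oo _ R
  (fun k => dot (h_ k) (col4 dw db dv (lin (w_ k) (v_ k) dw db dv)))).
  apply: cvg_dot => //; do 3 (apply: cvg_col_mx; first exact: cvg_cst).
  exact: ll.
apply: filterS near_st => k stk.
apply: (regular_normal_strict (b := b_ k) _ stk).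
  by rewrite -feas_setE -zE.
by rewrite -zE.
Qed.

(** Decreasing every bias by [eps] lowers both [u] and [alpha u] while [v]
    stays put, because the rows of [A] sum to one.  This makes any weakly
    linearized-feasible direction strict. *)
Lemma limiting_normal_polar w b v u eta dw db dv :
  feas w b v u -> limiting_normal feas_set (col4 w b v u) eta ->
  (forall i, (u i 0 = v i 0 -> lin w v dw db dv i 0 <= dv i 0) /\
    (alpha * u i 0 = v i 0 -> alpha * lin w v dw db dv i 0 <= dv i 0)) ->
  dot eta (col4 dw db dv (lin w v dw db dv)) <= 0.
Proof.
move=> [uv auv uE] etaN weak.
apply: (@le0_of_le_eps R _
  (dot eta (col4 0 (const_mx 1) 0 (const_mx 1)))) => e e0.
pose db' := db - e *: const_mx 1.
have linE : lin w v dw db' dv = lin w v dw db dv - e *: const_mx 1.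
  by rewrite /lin mulmxBr -scalemxAr A1 addrA.
have : strict w v u dw db' dv.
  move=> i; have [weak1 weak2] := weak i; rewrite linE.
  move: (lin w v dw db dv) weak1 weak2 => du weak1 weak2; rewrite !mxE; split.
    have := uv i; rewrite le_eqVlt => /predU1P[/weak1 ?|]; last by left.
    by right; lra.
  have := auv i; rewrite mxE le_eqVlt => /predU1P[/weak2 ?|]; last by left.
  by right; have := mulr_gt0 alpha_gt0 e0; lra.
move=> /limiting_normal_strict /(_ etaN).
have -> : col4 dw db' dv (lin w v dw db' dv) =
    col4 dw db dv (lin w v dw db dv) -
    e *: col4 0 (const_mx 1) 0 (const_mx 1).
  by rewrite linE !(scale_col_mx, opp_col_mx, add_col_mx, scaler0, subr0).
by rewrite dotDr dotNr dotZr subr_le0.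
Qed.

Lemma lin_linear w v k dw db dv dw' db' dv' :
  lin w v (k *: dw + dw') (k *: db + db') (k *: dv + dv') =
  k *: lin w v dw db dv + lin w v dw' db' dv'.
Proof.
rewrite /lin (linearP DPsi) !mulmxDr mulmxDl -!scalemxAr -scalemxAl.
by apply/colP => i; rewrite !mxE /=; ring.
Qed.

(** The normal vector [(etaw, etab, etav, etau)] is the gradient of
    [mu1 . (u - v) + mu2 . (alpha u - v) + xi . (u - Psi v *m w - A *m b)].  The
    [v] component is stated weakly, which avoids naming the adjoint of
    [dv |-> DPsi dv *m w]. *)
Definition multipliers w v u (etaw : 'cV[R]_a) (etab : 'cV[R]_c)
    (etav etau mu1 mu2 xi : 'cV[R]_p) : Prop :=
  [/\ mxle 0 mu1, mxle 0 mu2,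
      dot mu1 (u - v) + dot mu2 (alpha *: u - v) = 0 &
  [/\ etaw = - ((Psi v)^T *m xi), etab = - (A^T *m xi),
      etau = mu1 + alpha *: mu2 + xi &
      forall dv, dot etav dv = - dot (mu1 + mu2) dv - dot xi (DPsi dv *m w)]].

(** Farkas' lemma is applied in the space of free directions [(dw, db, dv)],
    with [du] eliminated by the linearized equality; an inactive inequality enters
    with coefficient zero, so complementarity holds by construction.  The
    multiplier [xi] is then read off from the [u] component. *)
Lemma limiting_normal_multipliers w b v u etaw etab etav etau :
  feas w b v u ->
  limiting_normal feas_set (col4 w b v u) (col4 etaw etab etav etau) ->
  exists mu1 mu2 xi, multipliers w v u etaw etab etav etau mu1 mu2 xi.
Proof.
move=> fe etaN; pose W := ('cV[R]_a * 'cV[R]_c * 'cV[R]_p)%type.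
pose du (D : W) := lin w v D.1.1 D.1.2 D.2.
have du_lin k D D' : du (k *: D + D') = k *: du D + du D' by exact: lin_linear.
pose act1 i : R := (u i 0 == v i 0)%:R.
pose act2 i : R := (alpha * u i 0 == v i 0)%:R.
pose phi1 i (D : W) : R^o := act1 i * (du D i 0 - D.2 i 0).
pose phi2 i (D : W) : R^o := act2 i * (alpha * du D i 0 - D.2 i 0).
have phi1P i : linear (phi1 i).
  by move=> k D D'; rewrite /phi1 du_lin !mxE /= /GRing.scale /=; ring.
have phi2P i : linear (phi2 i).
  by move=> k D D'; rewrite /phi2 du_lin !mxE /= /GRing.scale /=; ring.
pose psi (D : W) : R^o :=
  dot (col4 etaw etab etav etau) (col4 D.1.1 D.1.2 D.2 (du D)).
have psiP : linear psi.
  move=> k D D'; rewrite /psi du_lin; move: (du D) (du D') => e e'.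
  rewrite /= !dot_col_mx !dotDr !dotZr.
  by rewrite /GRing.scale /=; ring.
pose L1 i : {linear W -> R^o} :=
  HB.pack (phi1 i) (GRing.isLinear.Build _ _ _ _ _ (phi1P i)).
pose L2 i : {linear W -> R^o} :=
  HB.pack (phi2 i) (GRing.isLinear.Build _ _ _ _ _ (phi2P i)).
pose Lpsi : {linear W -> R^o} :=
  HB.pack psi (GRing.isLinear.Build _ _ _ _ _ psiP).
pose L (i : 'I_(p + p)) :=
  match fintype.split i with inl j => L1 j | inr j => L2 j end.
have Ll j : L (lshift p j) = L1 j.
  by rewrite /L -[lshift _ _]/(unsplit (inl j)) unsplitK.
have Lr j : L (rshift p j) = L2 j.
  by rewrite /L -[rshift _ _]/(unsplit (inr j)) unsplitK.
have [D Dle|mu mu0 psiE] := @farkas R W _ L Lpsi.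
  apply: (limiting_normal_polar fe etaN) => i; split=> [/eqP eq1|/eqP eq2].
    by have := Dle (lshift p i); rewrite Ll /= /phi1 /act1 eq1 mul1r subr_le0.
  by have := Dle (rshift p i); rewrite Lr /= /phi2 /act2 eq2 mul1r subr_le0.
pose mu1 : 'cV[R]_p := \col_i (mu (lshift p i) * act1 i).
pose mu2 : 'cV[R]_p := \col_i (mu (rshift p i) * act2 i).
have key dw db dv : dot (col4 etaw etab etav etau)
      (col4 dw db dv (lin w v dw db dv)) =
    dot mu1 (lin w v dw db dv - dv) + dot mu2 (alpha *: lin w v dw db dv - dv).
  have := psiE (dw, db, dv); rewrite /= /psi /= /du /= => ->.
  rewrite big_split_ord /= !dotE; congr (_ + _); apply: eq_bigr => i _.
    by rewrite Ll /= /phi1 !mxE mulrA.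
  by rewrite Lr /= /phi2 !mxE mulrA.
exists mu1, mu2, (etau - mu1 - alpha *: mu2).
split.
- by move=> i; rewrite !mxE mulr_ge0// /act1 ler0n.
- by move=> i; rewrite !mxE mulr_ge0// /act2 ler0n.
- rewrite !dotE !big1 ?addr0// => i _; rewrite !mxE.
    rewrite /act2; case: eqP => [->|_]; first by rewrite subrr mulr0.
    by rewrite mulr0 mul0r.
  rewrite /act1; case: eqP => [->|_]; first by rewrite subrr mulr0.
  by rewrite mulr0 mul0r.
split.
- apply/dot_eqP => dw; have := key dw 0 0.
  rewrite /lin !mulmx0 linear0 mul0mx !addr0 subr0 !dot_col_mx !dot0r.
  rewrite dotNl -dot_mulmxr !dotDl !dotNl !dotZl.
  by rewrite !dotDr !dotZr dotNr dot0r; lra.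
- apply/dot_eqP => db; have := key 0 db 0.
  rewrite /lin !mulmx0 linear0 mul0mx !add0r !subr0 !dot_col_mx !dot0r.
  by rewrite dotNl -dot_mulmxr !dotDl !dotNl !dotZl dotZr; lra.
- by apply/colP => i; rewrite !mxE; ring.
move=> dv; have := key 0 0 dv.
rewrite /lin !mulmx0 !add0r !addr0 !dot_col_mx !dot0r.
by rewrite !dotDr !dotDl !dotNl !dotZl !dotNr !dotZr; lra.
Qed.

(** The Lagrangian identity makes the first-order part of [dot eta] nonpositive
    on the feasible set; what remains is the bilinear remainder
    [DPsi dv *m dw], of second order. *)
Lemma multipliers_regular_normal w b v u etaw etab etav etau mu1 mu2 xi :
  feas w b v u -> multipliers w v u etaw etab etav etau mu1 mu2 xi ->
  regular_normal feas_set (col4 w b v u) (col4 etaw etab etav etau).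
Proof.
move=> [_ _ uE] [mu10 mu20 compl [-> -> -> etavE]] e e0.
pose vz (z : 'cV[R]_(a + (c + (p + p)))) := usubmx (dsubmx (dsubmx z)).
pose r z := (DPsi (vz z - v))^T *m xi.
have r0 : (fun z => \sum_i `|r z i 0|) @ nbhs (col4 w b v u) --> (0 : R).
  (* occurrence 1 of 0 is the neutral element of the sum, 2 is the limit *)
  have {2}<- : \sum_i `|((DPsi 0)^T *m xi) i 0| = 0.
    by rewrite linear0 trmx0 mul0mx big1// => i _; rewrite mxE normr0.
  apply: (@cvg_sum_ord _ _ (nbhs (col4 w b v u)) _ _ (fun i z => `|r z i 0|)).
  move=> i; apply: cvg_norm; apply: cvg_coord.
  apply: cvg_mulmx; last exact: cvg_cst.
  apply: cvg_mx => j k; rewrite mxE; under eq_fun do rewrite mxE.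
  apply: (@cvg_coord _ _ _ _ _ _ (fun z => DPsi (vz z - v))).
  apply: cvg_linear_mx.
  rewrite -[X in _ --> X](subrr v); apply: cvgB; last exact: cvg_cst.
  have vzE : vz (col4 w b v u) = v by rewrite /vz !(col_mxKu, col_mxKd).
  rewrite -[X in _ --> X]vzE.
  by apply: cvg_usubmx; do 2 apply: cvg_dsubmx; apply: cvg_id.
have near_r : \forall z \near col4 w b v u, \sum_i `|r z i 0| < e.
  exact: cvgr_lt r0 _ e0.
apply: (@filterS _ (nbhs (col4 w b v u)) _ _ _ _ near_r) => z /= rz Zz.
pose w' := usubmx z; pose b' := usubmx (dsubmx z).
pose u' := dsubmx (dsubmx (dsubmx z)).
have zE : z = col4 w' b' (vz z) u' by rewrite !vsubmxK.
move: Zz; rewrite {1}zE feas_setE => -[uv' auv' uE'].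
have -> : z - col4 w b v u = col4 (w' - w) (b' - b) (vz z - v) (u' - u).
  by rewrite {1}zE !(opp_col_mx, add_col_mx).
have [w_le _] := enorm_col_mx_ge (w' - w)
  (col_mx (b' - b) (col_mx (vz z - v) (u' - u))).
have PsivE : Psi (vz z) = Psi v + DPsi (vz z - v).
  by rewrite -PsiD addrC subrK.
(* the bilinear remainder is the only term without a sign *)
have step : dot xi (DPsi (vz z - v) *m (w' - w)) <= e * enorm (w' - w).
  rewrite dot_mulmxr (le_trans (dot_le_sum_enorm _ _))//.
  by rewrite ler_wpM2r ?enorm_ge0// ltW.
apply: (@le_trans _ _ (e * enorm (w' - w))); last by rewrite ler_wpM2l// ltW.
apply: le_trans step.
have sgn (mu x y : 'cV[R]_p) : mxle 0 mu -> mxle x y -> dot mu (x - y) <= 0.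
  move=> mu0 xy; rewrite dotE sumr_le0// => i _; rewrite mulr_ge0_le0//.
    by have := mu0 i; rewrite mxE.
  by rewrite !mxE subr_le0.
have := sgn _ _ _ mu10 uv'; have := sgn _ _ _ mu20 auv'; move: compl.
have duE : dot xi (u' - u) = dot xi (Psi v *m (w' - w))
    + dot xi (DPsi (vz z - v) *m w) + dot xi (A *m (b' - b))
    + dot xi (DPsi (vz z - v) *m (w' - w)).
  rewrite uE' uE PsivE mulmxDl !mulmxBr !(dotDr, dotNr); ring.
rewrite !dot_col_mx !dotNl -!dot_mulmxr etavE !dotDl duE !dotZl.
by rewrite !(dotDr, dotNr, dotZr); lra.
Qed.

Lemma limiting_normal_feas_set w b v u etaw etab etav etau :
  feas w b v u ->
  limiting_normal feas_set (col4 w b v u) (col4 etaw etab etav etau) <->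
  exists mu1 mu2 xi, multipliers w v u etaw etab etav etau mu1 mu2 xi.
Proof.
move=> fe; split=> [|[mu1 [mu2 [xi mult]]]].
  exact: limiting_normal_multipliers.
exists (fun=> col4 w b v u), (fun=> col4 etaw etab etav etau); split.
- by move=> _; rewrite feas_setE.
- exact: cvg_cst.
- by move=> _; exact: multipliers_regular_normal mult.
- exact: cvg_cst.
Qed.

End FeasibleSet.

(** * The network problem *)

Section NetworkAlgebra.
Context {R : realType} {L N : nat} {d : nat -> nat}.
Implicit Types (x : 'I_N -> 'cV[R]_(d 0%N)) (v h : 'cV[R]_(vdim N d L)).

(** Zero data give the linear part: [V_] and hence [Psi] are affine in [v], and
    only the block of the first layer, which holds the data, has a constant term. *)
Lemma V_affine x v h k l :
  V_ x (v + k *: h) l = V_ x v l + k *: V_ (fun=> 0) h l.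
Proof.
apply/matrixP => i n; case: l i => [|l] i /=; first by rewrite !mxE mulr0 addr0.
by case: (_ =P true) => [lL|_]; rewrite !mxE ?mulr0 ?addr0.
Qed.

Lemma rect_mxdiag_affine (p q : 'I_L -> nat) k
    (B C : forall l, 'M[R]_(p l, q l)) :
  rect_mxdiag (fun l => B l + k *: C l) =
  rect_mxdiag B + k *: rect_mxdiag C.
Proof.
apply/matrixP => i j; rewrite !mxE.
case: eqP => [ij|_]; last by rewrite !mxE mulr0 addr0.
move: (tagnat.sig2 i) (tagnat.sig2 j); rewrite -ij => i2 j2.
by rewrite !conform_mx_id !mxE.
Qed.

Lemma Psi_affine x v h k :
  Psi x (v + k *: h) = Psi x v + k *: Psi (fun=> 0) h.
Proof.
rewrite /Psi -rect_mxdiag_affine; congr rect_mxdiag.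
apply: functional_extensionality_dep => l; rewrite V_affine.
by apply/matrixP => i j; rewrite !mxE; ring.
Qed.

Lemma Psi0_linear : linear (Psi (fun=> 0) : 'cV[R]_(vdim N d L) -> _).
Proof. by move=> k v h; rewrite [k *: v + h]addrC Psi_affine [RHS]addrC. Qed.

Lemma tensmx_mul_const1 m n p q (B : 'M[R]_(m, n)) (C : 'M[R]_(p, q)) i j :
  (tensmx B C *m (const_mx 1 : 'cV_(n * q))) (mxtens_index (i, j)) 0 =
  (B *m (const_mx 1 : 'cV_n)) i 0 * (C *m (const_mx 1 : 'cV_q)) j 0.
Proof.
rewrite !mxE big_distrlr /= pair_bigA /=.
rewrite (reindex (@mxtens_index n q)) /=; last first.
  by exists (@mxtens_unindex n q) => k _;
    rewrite (mxtens_indexK, mxtens_unindexK).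
apply: eq_bigr => -[k l] _; rewrite tensmxE !mxE; ring.
Qed.

(** Each entry of [u] contains exactly one bias, with coefficient one.  This is
    where the constraint qualification comes from. *)
Lemma A_mul_const1 :
  (A_ : 'M[R]_(vdim N d L, bdim d L)) *m (const_mx 1 : 'cV_(bdim d L)) =
  const_mx 1.
Proof.
rewrite /A_ /rect_mxdiag -[X in _ *m X]mxcol_const mul_mxblock_mxrow -[RHS]mxcol_const.
apply: eq_mxcol => l; rewrite (bigD1 l) //= eqxx conform_mx_id.
rewrite big1 ?addr0 => [|k kl]; last by rewrite eq_sym (negPf kl) mul0mx.
have castE m n n' (e : n = n') (B : 'M[R]_(m, n)) :
    castmx (erefl, e) B *m (const_mx 1 : 'cV_n') = B *m (const_mx 1 : 'cV_n).
  by case: _ / e; rewrite castmx_id.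
rewrite castE; apply/colP => i; rewrite -(mxtens_unindexK i).
case: (mxtens_unindex i) => n j; rewrite tensmx_mul_const1 mul1mx !mxE.
by rewrite big_ord1 !mxE !mulr1.
Qed.

End NetworkAlgebra.

Lemma cvg_sigma (R : realType) n alpha (T : Type) (F : set_system T)
    {FF : Filter F} (u_ : T -> 'cV[R]_n) (u : 'cV[R]_n) :
  u_ @ F --> u -> (fun t => sigma alpha (u_ t)) @ F --> sigma alpha u.
Proof.
move=> uu; apply: cvg_mx => i k; rewrite !mxE; under eq_fun do rewrite !mxE.
have ui : (fun t => u_ t i k) @ F --> u i k by exact: cvg_coord.
have aui : (fun t => alpha * u_ t i k) @ F --> alpha * u i k.
  by apply: cvgM => //; exact: cvg_cst.
rewrite maxr_absE; under eq_fun do rewrite maxr_absE.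
apply: cvgM; last exact: cvg_cst.
by apply: cvgD; [exact: cvgD | apply: cvg_norm; exact: cvgB].
Qed.

Section NetworkObjective.
Context {R : realType} {L N : nat} {d : nat -> nat}.
Variables (x : 'I_N -> 'cV[R]_(d 0%N)) (y : 'I_N -> 'cV[R]_(d L)).
Variables (alpha lambdaw lambdav : R) (beta : 'I_L -> R).
Hypothesis lambdav_ge0 : 0 <= lambdav.

Implicit Types (w : 'cV[R]_(wdim d L)) (b : 'cV[R]_(bdim d L)).
Implicit Types (v u h : 'cV[R]_(vdim N d L)).

Local Notation Obar := (Obar x y lambdaw lambdav).
Local Notation betavec := (@betavec R L N d beta).

Definition residual v n := col n (V_ x v L) - y n.

Definition dresidual h n := col n (V_ (fun=> 0 : 'cV[R]_(d 0%N)) h L).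

Lemma residual_affine v t h n :
  residual (v + t *: h) n = residual v n + t *: dresidual h n.
Proof.
rewrite /residual /dresidual V_affine.
by apply/colP => i; rewrite !mxE addrAC.
Qed.

Lemma dresidual_linear n : linear (dresidual^~ n).
Proof.
move=> k h h'; rewrite /dresidual [k *: h + h']addrC V_affine.
by apply/colP => i; rewrite !mxE addrC.
Qed.

Lemma cvg_residual (T : Type) (F : set_system T) {FF : Filter F}
    (v_ : T -> 'cV[R]_(vdim N d L)) v n :
  v_ @ F --> v -> (fun t => residual (v_ t) n) @ F --> residual v n.
Proof.
have resE v' : residual v' n = residual 0 n + dresidual v' n.
  by rewrite -[in LHS](add0r v') -[v' in LHS]scale1r residual_affine scale1r.
pose lin_res := GRing.isLinear.Build _ _ _ _ _ (dresidual_linear n).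
pose lres : {linear 'cV[R]_(vdim N d L) -> 'cV[R]_(d L)} :=
  HB.pack (dresidual^~ n) lin_res.
move=> vv; rewrite resE; under eq_fun do rewrite resE.
by apply: cvgD; [exact: cvg_cst | exact: (cvg_linear_mx (phi := lres))].
Qed.

(** The [v]-dependent part of [Obar]; [Dfit] and [Qfit] are its first- and
    second-order parts. *)
Definition fit v : R :=
  N%:R^-1 * \sum_(n < N) enorm (residual v n) ^+ 2 + R2 lambdav v.

Definition Dfit v h : R :=
  N%:R^-1 * \sum_(n < N) (2 * dot (residual v n) (dresidual h n))
  + lambdav * (2 * dot v h).

Definition Qfit h : R :=
  N%:R^-1 * \sum_(n < N) dot (dresidual h n) (dresidual h n)
  + lambdav * dot h h.

Lemma fit_quadratic v t h :
  fit (v + t *: h) = fit v + t * Dfit v h + t ^+ 2 * Qfit h.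
Proof.
have sqrD k (r p : 'cV[R]_k) : enorm (r + t *: p) ^+ 2 =
    enorm r ^+ 2 + t * (2 * dot r p) + t ^+ 2 * dot p p.
  by rewrite !enorm_sqr !(dotDl, dotDr, dotZl, dotZr) [dot p r]dotC; ring.
rewrite /fit /R2 sqrD; under eq_bigr do rewrite residual_affine sqrD.
by rewrite !big_split /= /Dfit /Qfit -!mulr_sumr; ring.
Qed.

Lemma Dfit_linear v : linear (Dfit v : _ -> R^o).
Proof.
move=> k h h'; rewrite /Dfit dotDr dotZr.
under eq_bigr do rewrite dresidual_linear dotDr dotZr mulrDr mulrCA.
by rewrite big_split /= -mulr_sumr /GRing.scale /=; ring.
Qed.

Lemma Qfit_ge0 h : 0 <= Qfit h.
Proof.
rewrite addr_ge0// mulr_ge0 ?invr_ge0 ?ler0n ?dot_ge0//.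
by rewrite sumr_ge0// => n _; exact: dot_ge0.
Qed.

Lemma Dfit_continuous h : continuous (Dfit^~ h).
Proof.
apply: continuous_of_cvg => T F FF v_ v vv; apply: cvgD; apply: cvgM; try exact: cvg_cst.
  apply: cvg_sum_ord => n; apply: cvgM; first exact: cvg_cst.
  by apply: cvg_dot; [exact: cvg_residual | exact: cvg_cst].
apply: cvgM; first exact: cvg_cst.
by apply: cvg_dot => //; exact: cvg_cst.
Qed.

Lemma fit_continuous : continuous fit.
Proof.
apply: continuous_of_cvg => T F FF v_ v vv; apply: cvgD; apply: cvgM; try exact: cvg_cst.
  by apply: cvg_sum_ord => n; apply: cvgM; apply: cvg_enorm; exact: cvg_residual.
by apply: cvgM; exact: cvg_enorm.
Qed.

Lemma ObarE w v : Obar w v = fit v + R1 lambdaw w.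
Proof. by rewrite /Obar /fit; ring. Qed.

Lemma dot_grad_Obar w v h : dot (grad (fun v' => Obar w v') v) h = Dfit v h.
Proof.
apply: (@dot_grad_quadratic _ _ _ Dfit Qfit); last exact: Dfit_linear.
by move=> v' t h'; rewrite !ObarE fit_quadratic; ring.
Qed.

Definition fit_pen v : R := fit v + dot betavec v.

Definition act_pen u : R := - dot betavec (sigma alpha u).

Lemma fit_pen_continuous : continuous fit_pen.
Proof.
apply: continuous_of_cvg => T F FF v_ v vv; apply: cvgD.
  by apply: continuous_cvg => //; exact: fit_continuous.
by apply: cvg_dot => //; exact: cvg_cst.
Qed.

Lemma limiting_subdiff_fit_pen w v g :
  limiting_subdiff fit_pen v g <->
  g = grad (fun v' => Obar w v') v + betavec.
Proof.
have quad v' t h' : fit_pen (v' + t *: h') =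
    fit_pen v' + t * (Dfit v' h' + dot betavec h') + t ^+ 2 * Qfit h'.
  by rewrite /fit_pen fit_quadratic dotDr dotZr; ring.
have Dlin v' : linear ((fun h' => Dfit v' h' + dot betavec h') : _ -> R^o).
  by move=> k h h'; rewrite Dfit_linear dotDr dotZr /GRing.scale /=; ring.
rewrite (limiting_subdiff_quadratic quad Dlin); first last.
- move=> h; apply: continuous_of_cvg => T F FF v_ v' vv.
  apply: cvgD; last exact: cvg_cst.
  apply: (@continuous_cvg _ _ _ F FF v_ (Dfit^~ h)) vv; exact: Dfit_continuous.
- exact: Qfit_ge0.
suff -> : grad fit_pen v = grad (fun v' => Obar w v') v + betavec by [].
apply/dot_eqP => h.
by rewrite (dot_grad_quadratic quad Dlin) dotDl dot_grad_Obar.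
Qed.

Lemma R1_continuous : continuous (R1 lambdaw : 'cV[R]_(wdim d L) -> R).
Proof.
apply: continuous_of_cvg => T F FF w_ w ww; apply: cvgM; first exact: cvg_cst.
apply: cvg_sum_ord => l; apply: cvg_sum_ord => j; apply: cvg_enorm.
apply: cvg_mx => i k; rewrite !mxE; under eq_fun do rewrite !mxE.
exact: cvg_coord.
Qed.

Lemma act_pen_continuous : continuous act_pen.
Proof.
apply: continuous_of_cvg => T F FF u_ u uu; apply: cvgN.
by apply: cvg_dot; [exact: cvg_cst | exact: cvg_sigma].
Qed.

Lemma PP_objE : PP_obj x y alpha lambdaw lambdav beta =
  sep_sum (R1 lambdaw) (sep_sum (fun=> 0) (sep_sum fit_pen act_pen)).
Proof.
apply/funext => z; rewrite /PP_obj /obj ObarE /sep_sum /fit_pen /act_pen.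
by rewrite dotDr dotNr /wpart /vpart /upart; ring.
Qed.

(** The biases enter only the constraints, so the [b] block of the objective is
    the zero function. *)
Lemma limiting_subdiff_PP_obj w b v u gw gb gv gu :
  limiting_subdiff (PP_obj x y alpha lambdaw lambdav beta) (pack w b v u)
    (col_mx gw (col_mx gb (col_mx gv gu))) <->
  [/\ limiting_subdiff (R1 lambdaw) w gw, gb = 0,
      gv = grad (fun v' => Obar w v') v + betavec &
      limiting_subdiff act_pen u gu].
Proof.
have cont_vu : continuous (sep_sum fit_pen act_pen).
  by apply: sep_sum_continuous; [exact: fit_pen_continuous | exact: act_pen_continuous].
have cont0 : continuous (fun _ : 'cV[R]_(bdim d L) => 0 : R).
  by apply: continuous_of_cvg => T F FF z_ z zz; exact: cvg_cst.
have cont_bvu : continuous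
    (sep_sum (fun _ : 'cV[R]_(bdim d L) => 0) (sep_sum fit_pen act_pen)).
  exact: sep_sum_continuous.
have zeroP : limiting_subdiff (fun _ : 'cV[R]_(bdim d L) => 0 : R) b gb <->
    gb = 0.
  have quad (b' : 'cV[R]_(bdim d L)) t b'' :
    (0 : R) = 0 + t * (fun _ _ => 0) b' b'' + t ^+ 2 * (fun=> 0) b''.
    by rewrite !mulr0 !addr0.
  have Dlin (b' : 'cV[R]_(bdim d L)) :
      linear ((fun=> 0) : 'cV[R]_(bdim d L) -> R^o).
    by move=> k ? ?; rewrite scaler0 addr0.
  have Dcont (h : 'cV[R]_(bdim d L)) :
      continuous ((fun=> 0) : 'cV[R]_(bdim d L) -> R).
    by apply: continuous_of_cvg => T F FF z_ z zz; exact: cvg_cst.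
  rewrite (limiting_subdiff_quadratic quad Dlin _ _ (fun=> lexx 0) Dcont).
  suff -> : grad (fun _ : 'cV[R]_(bdim d L) => 0 : R) b = 0 by [].
  by apply/dot_eqP => h; rewrite (dot_grad_quadratic quad Dlin) dotC dot0r.
rewrite PP_objE /pack.
rewrite (limiting_subdiff_sep_sum _ _ _ _ R1_continuous cont_bvu).
rewrite (limiting_subdiff_sep_sum _ _ _ _ cont0 cont_vu).
rewrite (limiting_subdiff_sep_sum _ _ _ _ fit_pen_continuous act_pen_continuous).
rewrite zeroP (limiting_subdiff_fit_pen w).
by split=> [[? [? []]]|[]].
Qed.

End NetworkObjective.

Section NetworkMultipliers.
Context {R : realType} {L N : nat} {d : nat -> nat}.
Variables (x : 'I_N -> 'cV[R]_(d 0%N)) (alpha : R).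

Implicit Types (w : 'cV[R]_(wdim d L)) (b : 'cV[R]_(bdim d L)).
Implicit Types (v u h mu xi : 'cV[R]_(vdim N d L)).

Lemma Omega2E : @Omega2 R L N d x alpha = feas_set alpha (Psi x) A_.
Proof.
have sub_le n (r s : 'cV[R]_n) : mxle 0 (r - s) <-> mxle s r.
  by split=> rs i; have := rs i; rewrite !mxE subr_ge0.
by apply/seteqP; split=> z [? ? ?]; split=> //; exact/sub_le.
Qed.

Lemma dot_Cmap (mu1 mu2 : 'cV[R]_(vdim N d L)) v u :
  dot (col_mx mu1 mu2) (Cmap alpha v u) =
  dot mu1 (u - v) + dot mu2 (alpha *: u - v).
Proof. exact: dot_col_mx. Qed.

Lemma grad_Cmap_v (mu1 mu2 : 'cV[R]_(vdim N d L)) v u :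
  grad (fun v' => dot (col_mx mu1 mu2) (Cmap alpha v' u)) v = - (mu1 + mu2).
Proof.
apply: grad_affine => z h t; rewrite !dot_Cmap.
by rewrite !(dotDr, dotNr, dotZr, dotDl, dotNl); ring.
Qed.

Lemma grad_Cmap_u (mu1 mu2 : 'cV[R]_(vdim N d L)) v u :
  grad (fun u' => dot (col_mx mu1 mu2) (Cmap alpha v u')) u =
  mu1 + alpha *: mu2.
Proof.
apply: grad_affine => z h t; rewrite !dot_Cmap.
by rewrite !(dotDr, dotNr, dotZr, dotDl, dotZl); ring.
Qed.

Lemma dot_grad_Psi xi w v h :
  dot (grad (fun v' => dot xi (Psi x v' *m w)) v) h =
  dot xi (Psi (fun=> 0) h *m w).
Proof.
apply: (@dot_grad_quadratic _ _ _
  (fun _ h => dot xi (Psi (fun=> 0) h *m w)) (fun=> 0)) => [z t h'|_ k h1 h2].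
  by rewrite Psi_affine mulmxDl -scalemxAl dotDr dotZr mulr0 addr0.
by rewrite Psi0_linear mulmxDl -scalemxAl dotDr dotZr.
Qed.

End NetworkMultipliers.

Theorem theorem5 (R : realType) (L N : nat) (d : nat -> nat)
    (x : 'I_N -> 'cV[R]_(d 0%N)) (y : 'I_N -> 'cV[R]_(d L))
    (alpha lambdaw lambdav : R) (beta : 'I_L -> R)
    (L_gt0 : (0 < L)%N) (N_gt0 : (0 < N)%N)
    (d_gt0 : forall l : nat, (l <= L)%N -> (0 < d l)%N)
    (alpha_gt0 : 0 < alpha) (alpha_lt1 : alpha < 1)
    (lambdaw_gt0 : 0 < lambdaw) (lambdav_gt0 : 0 < lambdav)
    (beta_gt0 : forall l : 'I_L, 0 < beta l)
    (w : 'cV[R]_(wdim d L)) (b : 'cV[R]_(bdim d L))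
    (v u : 'cV[R]_(vdim N d L)) :
  limiting_stationary (PP_obj x y alpha lambdaw lambdav beta)
    (Omega2 x alpha) (pack w b v u)
  <-> KKT_point x y alpha lambdaw lambdav beta w b v u.
Proof.
pose DPsi : {linear 'cV[R]_(vdim N d L) -> 'M[R]_(vdim N d L, wdim d L)} :=
  HB.pack (Psi (fun=> 0 : 'cV[R]_(d 0%N)))
    (GRing.isLinear.Build _ _ _ _ _ (@Psi0_linear R L N d)).
have PsiD v1 h : Psi x (v1 + h) = Psi x v1 + DPsi h.
  by rewrite -[h in LHS]scale1r Psi_affine scale1r.
have normalP := limiting_normal_feas_set (DPsi := DPsi) PsiD alpha_gt0
  (@A_mul_const1 R L N d) (w := w) (b := b) (v := v) (u := u).
have subdiffP := @limiting_subdiff_PP_obj R L N d x y alpha lambdaw lambdav beta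
  (ltW lambdav_gt0) w b v u.
have feasP : Omega2 x alpha (pack w b v u) =
    feas alpha (Psi x) A_ w b v u by rewrite Omega2E feas_setE.
split.
  move=> [Zz [g [h [gO hN gh0]]]].
  have fe : feas alpha (Psi x) A_ w b v u by rewrite -feasP.
  move: gO; rewrite -[g]vsubmxK -[dsubmx g]vsubmxK -[dsubmx (dsubmx g)]vsubmxK.
  move=> /subdiffP.
  set gw := usubmx g; set gb := usubmx _; set gv := usubmx _; set gu := dsubmx _.
  move=> [R1g gb0 gvE hu].
  have hE : h = col_mx (- gw) (col_mx (- gb) (col_mx (- gv) (- gu))).
    by rewrite -!opp_col_mx !vsubmxK; apply/eqP; rewrite -addr_eq0 addrC -gh0.
  move: hN; rewrite hE Omega2E => /(normalP _ _ _ _ fe).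
  move=> [mu1 [mu2 [xi [mu10 mu20 compl [gwE gbE guE gvxi]]]]].
  exists (col_mx mu1 mu2), xi; split.
  - move=> i; rewrite !mxE.
    by case: (fintype.split i) => k; [have := mu10 k | have := mu20 k]; rewrite mxE.
  - by exists gw => //; rewrite -(opprK gw) gwE opprK subrr.
  - by apply/eqP; rewrite eq_sym -oppr_eq0 -gbE gb0 oppr0.
  - apply/dot_eqP => dv; rewrite grad_Cmap_v -gvE !(dotDl, dotNl) dot_grad_Psi.
    by have := gvxi dv; rewrite [dot 0 dv]dotC dot0r dotNl dotDl /=; lra.
  split.
  - exists gu => //; rewrite grad_Cmap_u -addrA addrC.
    by apply/eqP; rewrite eq_sym addr_eq0 guE.
  - case: fe => uv auv _ i; rewrite !mxE.
    by case: (fintype.split i) => k; rewrite !mxE subr_le0 ?uv //;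
      have := auv k; rewrite mxE.
  - by rewrite dot_Cmap.
  - by case: fe => _ _ ->; rewrite addrAC addrK subrr.
move=> [mu [xi [mu0 [gw R1g gwE] AE vE [[gu hu guE] Cle compl uE]]]].
move: mu0 vE guE compl; rewrite -(vsubmxK mu).
set mu1 := usubmx mu; set mu2 := dsubmx mu => mu0 vE guE compl.
have fe : feas alpha (Psi x) A_ w b v u.
  split=> [i|i|].
  - by have := Cle (lshift _ i); rewrite /Cmap col_mxEu !mxE subr_le0.
  - by have := Cle (rshift _ i); rewrite /Cmap col_mxEd !mxE subr_le0.
  - by apply/eqP; rewrite -subr_eq0 opprD addrA uE.
split; first by rewrite feasP.
pose gv := grad (fun v' => Obar x y lambdaw lambdav w v') v + betavec beta.
exists (col_mx gw (col_mx 0 (col_mx gv gu))).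
exists (col_mx (- gw) (col_mx (- 0) (col_mx (- gv) (- gu)))); split.
- exact/subdiffP.
- rewrite Omega2E; apply/(normalP _ _ _ _ fe); exists mu1, mu2, xi; split.
  + by move=> i; have := mu0 (lshift _ i); rewrite col_mxEu !mxE.
  + by move=> i; have := mu0 (rshift _ i); rewrite col_mxEd !mxE.
  + by rewrite -dot_Cmap.
  split.
  + by congr (- _); apply/eqP; rewrite -subr_eq0 -gwE.
  + by rewrite -AE.
  + apply/eqP; rewrite eq_sym -addr_eq0 ?opprK.
    by rewrite guE grad_Cmap_u; apply/eqP; rewrite addrC addrA.
  move=> dv; rewrite dotNl -/gv.
  have := congr1 (fun g => dot g dv) vE.
  rewrite /gv grad_Cmap_v !(dotDl, dotNl) dot_grad_Psi [dot 0 dv]dotC dot0r /=.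
  by lra.
- by rewrite -!opp_col_mx subrr.
Qed.
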